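(* Let $b\ge2$. The set of all finite products, under convolution $*$, of functions of the forms \[S_{(a;b)}(t),\qquad (I-T^a)\,\delta_{\mathbb{Z}}\!\left(\tfrac{t}{b}\right),\qquad S_b(t),\] where $a$ ranges over positive integers with $\gcd(a,b)=1$, is an abelian group with identity $S_b$. The inverse of $S_{(a;b)}$ in this group is $(I-T^a)\,\delta_{\mathbb{Z}}(t/b)$.
   Context: $\xi_b=e^{2\pi i/b}$; $S_{(a;b)}(n)=\frac1b\sum_{j=1}^{b-1}\frac{\xi_b^{jn}}{1-\xi_b^{ja}}$ and $S_b(n)=\frac1b\sum_{j=1}^{b-1}\xi_b^{jn}$. For $b$-periodic functions $f,g$ on $\mathbb{Z}$, $(f*g)(t)=\sum_{m=0}^{b-1}f(t-m)g(m)$. $\delta_{\mathbb{Z}}(x)=1$ if $x\in\mathbb{Z}$ and $0$ otherwise; $I$ is the identity operator and $(T^ah)(t)=h(t+a)$. *)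

(* Defs.v *)
From HB Require Import structures.
From mathcomp Require Import all_boot all_order all_algebra.
From mathcomp Require Import complex.
From mathcomp Require Import all_classical all_reals all_analysis.
Set Implicit Arguments.
Unset Strict Implicit.
Unset Printing Implicit Defensive.
Import Order.TTheory GRing.Theory Num.Theory.
Local Open Scope ring_scope.
Local Open Scope complex_scope.

Section PeriodicFunctions.
Variables (R : realType) (b : nat).
Implicit Types (t n : int) (a : nat).

Definition periodic_fun := {f : int -> R[i] | periodic f b%:Z}.

(* xi_b = e^(2 pi i / b), by Euler's formula. *)
Definition xi : R[i] :=
  cos (2 * pi / b%:R) +i* sin (2 * pi / b%:R).

Definition S_raw a : int -> R[i] := fun n =>
  b%:R^-1 * \sum_(1 <= j < b) xi ^ (j%:Z * n) / (1 - xi ^+ (j * a)).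

Definition Sb_raw : int -> R[i] := fun n =>
  b%:R^-1 * \sum_(1 <= j < b) xi ^ (j%:Z * n).

Definition delta_Z (x : R) : R[i] := (x \is a Num.int)%:R.

Definition shift_by a (h : int -> R[i]) : int -> R[i] := fun t => h (t + a%:Z).

(* (I - T^a) applied to the function t |-> delta_Z (t / b) of the integer
   variable t; the shift acts on t, not on the quotient t / b. *)
Definition D_raw a : int -> R[i] :=
  let h := fun t => delta_Z (t%:~R / b%:R) in fun t => h t - shift_by a h t.

Definition convolution_raw (f g : int -> R[i]) : int -> R[i] := fun t =>
  \sum_(0 <= m < b) f (t - m%:Z) * g m%:Z.

Lemma xi_neq0 : xi != 0.
Proof.
apply/eqP; rewrite /xi => -[c0 s0].
by have := cos2Dsin2 (2 * pi / b%:R : R); rewrite c0 s0 expr0n addr0 => /esym/eqP; rewrite oner_eq0.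
Qed.

Lemma xi_exp k :
  xi ^+ k = cos ((2 * pi / b%:R) *+ k) +i* sin ((2 * pi / b%:R) *+ k).
Proof.
elim: k => [|k IH]; first by rewrite expr0 mulr0n cos0 sin0.
by rewrite exprSr IH (mulrSr (2 * pi / b%:R)) cosD sinD; simpc; congr (_ +i* _); rewrite addrC.
Qed.

Lemma xi_b : xi ^+ b = 1.
Proof.
rewrite xi_exp; have [->|b0] := eqVneq b 0%N; first by rewrite mulr0n cos0 sin0.
rewrite -[X in cos X]mulr_natr -[X in sin X]mulr_natr divfK ?pnatr_eq0//.
by rewrite mulr_natl cos2pi sin2pi.
Qed.

Lemma xi_periodic j : periodic (fun n => xi ^ (j%:Z * n)) b%:Z.
Proof.
move=> n; rewrite mulrDr expfzDr ?xi_neq0//.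
by rewrite [j%:Z * b%:Z]mulrC -(exprz_exp _ b%:Z) -(exprnP xi b) xi_b exp1rz mulr1.
Qed.

Lemma S_periodic a : periodic (S_raw a) b%:Z.
Proof.
move=> n; rewrite /S_raw; congr (_ * _).
by apply: eq_bigr => j _; rewrite xi_periodic.
Qed.

Lemma Sb_periodic : periodic Sb_raw b%:Z.
Proof.
by move=> n; rewrite /Sb_raw; congr (_ * _); apply: eq_bigr => j _; rewrite xi_periodic.
Qed.

Lemma delta_periodic : periodic (fun t => delta_Z (t%:~R / b%:R)) b%:Z.
Proof.
move=> t; have [->|b0] := eqVneq b 0%N; first by rewrite addr0.
by rewrite /delta_Z rmorphD/= mulrDl divff ?pnatr_eq0// rpredDr ?rpred1.
Qed.

Lemma D_periodic a : periodic (D_raw a) b%:Z.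
Proof.
move=> t; rewrite /D_raw /shift_by delta_periodic.
by rewrite (addrAC t b%:Z) delta_periodic.
Qed.

Lemma convolution_periodic (f g : int -> R[i]) :
  periodic f b%:Z -> periodic (convolution_raw f g) b%:Z.
Proof.
by move=> fb t; apply: eq_bigr => m _; rewrite addrAC fb.
Qed.

Definition S_ab a : periodic_fun := exist _ (S_raw a) (S_periodic a).

Definition S_b : periodic_fun := exist _ Sb_raw Sb_periodic.

Definition D_ab a : periodic_fun := exist _ (D_raw a) (D_periodic a).

Definition convolution (f g : periodic_fun) : periodic_fun :=
  exist _ (convolution_raw (sval f) (sval g)) (convolution_periodic (sval g) (svalP f)).

Inductive generator : periodic_fun -> Prop :=
| generator_S_ab a : (0 < a)%N -> coprime a b -> generator (S_ab a)
| generator_D_ab a : (0 < a)%N -> coprime a b -> generator (D_ab a)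
| generator_S_b : generator S_b.

(* Products of at least one factor: the empty product would be the neutral
   element delta_Z (t / b) of the convolution of all periodic functions, which
   is not S_b. *)
Inductive convolution_product : periodic_fun -> Prop :=
| convolution_product1 g : generator g -> convolution_product g
| convolution_productM g h : generator g -> convolution_product h -> convolution_product (convolution g h).

End PeriodicFunctions.

Definition is_inverse (X : Type) (G : set X) (op : X -> X -> X) (e x y : X) : Prop :=
  [/\ G x, G y, op x y = e & op y x = e].

Record is_abelian_group (X : Type) (G : set X) (op : X -> X -> X) (e : X) : Prop := {
  abelian_closed : forall x y, G x -> G y -> G (op x y);
  abelian_assoc : forall x y z, G x -> G y -> G z -> op x (op y z) = op (op x y) z;
  abelian_comm : forall x y, G x -> G y -> op x y = op y x;
  abelian_id : G e;
  abelian_idl : forall x, G x -> op e x = x;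
  abelian_inv : forall x, G x -> exists y, is_inverse G op e x y }.

(* Main.v *)
Require Import Defs.
From mathcomp Require Import all_boot all_order all_algebra.
From mathcomp Require Import complex.
From mathcomp Require Import ring lra.
From mathcomp Require Import all_classical all_reals all_analysis.

(** The functions [n |-> b^-1 * \sum_(1 <= j < b) xi ^ (j n) * c j] multiply
    coefficientwise under convolution, by orthogonality of the characters
    [n |-> xi ^ (j n)].  All three generators have this form, with [c j] equal to
    [(1 - xi ^ (j a))^-1], [1 - xi ^ (j a)] and [1]; for [D_ab] this holds because
    the coefficient at [j = 0] vanishes.  The coefficients are nonzero as [xi] is a
    primitive [b]-th root of unity and [a] is prime to [b]. *)

Set Implicit Arguments.
Unset Strict Implicit.
Unset Printing Implicit Defensive.
Import Order.TTheory GRing.Theory Num.Theory.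
Local Open Scope ring_scope.
Local Open Scope complex_scope.

Section Fourier.
Variables (R : realType) (b : nat) (b_gt1 : (1 < b)%N).
Local Notation xi := (xi R b).
Implicit Types f g h : periodic_fun R b.

Let b_neq0 : b%:R != 0 :> R[i].
Proof. by rewrite pnatr_eq0 -lt0n ltnW. Qed.

(** The half angle [x = pi k / b] lies strictly between 0 and [pi], so [sin x > 0] and the real part
    [cos (2 x) = 1 - 2 (sin x)^2] is less than 1. *)
Lemma xi_exp_neq1 k : (0 < k < b)%N -> xi ^+ k != 1.
Proof.
case/andP=> k0 kb; rewrite xi_exp; apply/eqP => -[cos1 _].
have b0 : 0 < b%:R :> R by rewrite ltr0n ltnW.
pose x : R := pi * (k%:R / b%:R).
have x2 : (2 * pi / b%:R) *+ k = x *+ 2.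
  by rewrite /x -mulr_natr -[RHS]mulr_natr; ring.
have sinx : 0 < sin x.
  apply: sin_gt0_pi; rewrite /x mulr_gt0 ?pi_gt0 ?divr_gt0 ?ltr0n ?(ltnW b_gt1)//=.
  by rewrite gtr_pMr ?pi_gt0// ltr_pdivrMr// mul1r ltr_nat.
have := cos2Dsin2 x; move: cos1; rewrite x2 cos_mulr2n => cos2 sin2; nra.
Qed.

Lemma xi_prim : b.-primitive_root xi.
Proof.
rewrite /primitive_root_of_unity ltnW//=; apply/forallP => i.
rewrite unity_rootE; have [->|ib] := eqVneq i.+1 b; first by rewrite xi_b !eqxx.
by rewrite (negbTE (xi_exp_neq1 _))//= ltn_neqAle ib ltn_ord.
Qed.

Lemma xi_exprz_eq1 (t : int) : (xi ^ t == 1) = (b%:Z %| t)%Z.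
Proof.
rewrite dvdzE; case: t => n; first by rewrite -exprnP -(prim_order_dvd xi_prim).
by rewrite NegzE abszN -invr_expz invr_eq1 -exprnP -(prim_order_dvd xi_prim).
Qed.

Lemma sum_xi (t : int) :
  \sum_(0 <= j < b) xi ^ (j%:Z * t) = b%:R * (b%:Z %| t)%Z%:R.
Proof.
under eq_bigr do rewrite mulrC -exprz_exp -exprnP.
rewrite -xi_exprz_eq1; have [->|xt1] := eqVneq (xi ^ t) 1.
  under eq_bigr do rewrite expr1n.
  by rewrite sumr_const_nat subn0 mulr1.
(* The sum is geometric with ratio [xi ^ t]; multiplying it by [xi ^ t - 1] gives
   [xi ^ (t b) - 1 = 0]. *)
apply: (mulfI (x := xi ^ t - 1)); first by rewrite subr_eq0.
rewrite big_mkord -subrX1 exprnP exprz_exp mulrC -exprz_exp -exprnP xi_b.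
by rewrite exp1rz subrr mulr0 mulr0.
Qed.

(** Inverse discrete Fourier transform with zero coefficient at the trivial character [j = 0]. This
    omission makes [S_b], rather than the delta function, the neutral element. *)
Definition fourier (c : nat -> R[i]) (n : int) : R[i] :=
  b%:R^-1 * \sum_(1 <= j < b) xi ^ (j%:Z * n) * c j.

Lemma convolution_fourier c d :
  convolution_raw b (fourier c) (fourier d) = fourier (fun j => c j * d j).
Proof.
apply/funext => t; rewrite /convolution_raw /fourier.
under eq_bigr => m _ do rewrite mulrACA mulr_suml mulr_sumr.
rewrite exchange_big /= mulr_sumr; apply: eq_big_nat => j /andP[j0 jb].
(* Since [j (t - m) + k m = j t + m (k - j)], the sum over [m] becomes a character sum at
   [k - j]. *)
transitivity (b%:R^-1 * b%:R^-1 * \sum_(1 <= k < b)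
   xi ^ (j%:Z * t) * (c j * d k) * \sum_(0 <= m < b) xi ^ (m%:Z * (k%:Z - j%:Z))).
  rewrite -mulr_sumr; congr (_ * _).
  under eq_bigr => m _ do rewrite mulr_sumr.
  rewrite exchange_big /=; apply: eq_bigr => k _.
  rewrite mulr_sumr; apply: eq_bigr => m _.
  rewrite mulrACA [RHS]mulrAC -!expfzDr ?xi_neq0//; congr (xi ^ _ * _).
  ring.
(* Only [k = j] survives, where the character sum [b] cancels one factor [b^-1]; distinct indices in
   [[1, b)] are incongruent mod [b]. *)
rewrite (bigD1_seq j) ?mem_index_iota ?j0 ?iota_uniq//=.
rewrite [X in _ + X]big_nat_cond [X in _ + X]big1 => [|k /andP[/andP[k0 kb] kj]].
  by rewrite addr0 sum_xi subrr dvdz0 mulr1; field.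
rewrite sum_xi -eqz_mod_dvd !modz_small ?ltz_nat ?lez_nat//=.
by rewrite eqz_nat (negbTE kj) !mulr0.
Qed.

Lemma delta_Z_fourier (t : int) :
  delta_Z (t%:~R / b%:R : R) = b%:R^-1 * \sum_(0 <= j < b) xi ^ (j%:Z * t).
Proof.
rewrite sum_xi mulKf// /delta_Z; congr (nat_of_bool _)%:R.
have bR : b%:R != 0 :> R by rewrite pnatr_eq0 -lt0n ltnW.
apply/intrP/dvdzP => -[q tq]; exists q.
  by apply: (@intr_inj R); rewrite intrM -tq divfK.
by rewrite tq intrM mulfK.
Qed.

Lemma S_ab_fourier a : sval (S_ab R b a) = fourier (fun j => (1 - xi ^+ (j * a))^-1).
Proof. by []. Qed.

Lemma S_b_fourier : sval (S_b R b) = fourier (fun=> 1).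
Proof.
by apply/funext => n /=; congr (_ * _); apply: eq_bigr => j _; rewrite mulr1.
Qed.

(** The delta function has every coefficient equal to 1, and the shift by [a] multiplies the [j]-th
    one by [xi ^ (j a)]. *)
Lemma D_ab_fourier a : sval (D_ab R b a) = fourier (fun j => 1 - xi ^+ (j * a)).
Proof.
apply/funext => t; rewrite /= /D_raw /shift_by !delta_Z_fourier -mulrBr.
congr (_ * _); rewrite -sumrB big_ltn 1?ltnW// !mul0r subrr add0r.
apply: eq_bigr => j _.
by rewrite mulrDr expfzDr ?xi_neq0// mulrBr mulr1 exprnP PoszM.
Qed.

Lemma periodic_fun_eq (f g : periodic_fun R b) : sval f = sval g -> f = g.
Proof. by case: f g => [f pf] [g pg] /= fg; apply: eq_exist. Qed.

Lemma sval_convolution f g :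
  sval (convolution f g) = convolution_raw b (sval f) (sval g).
Proof. by []. Qed.

(** This reduces the commutative, associative and identity laws to those of pointwise multiplication
    of coefficients. *)
Lemma convolution_product_fourier f :
  convolution_product f -> exists c, sval f = fourier c.
Proof.
have gen g : generator g -> exists c, sval g = fourier c.
  by case=> [a _ _|a _ _|]; eexists;
    [exact: S_ab_fourier|exact: D_ab_fourier|exact: S_b_fourier].
elim=> [|g h /gen[c gc] _ [d hd]]; first exact: gen.
by exists (fun j => c j * d j); rewrite /= gc hd convolution_fourier.
Qed.

Lemma convolution_productC f g : convolution_product f -> convolution_product g ->
  convolution f g = convolution g f.
Proof.
move=> /convolution_product_fourier[c fc] /convolution_product_fourier[d gd].
apply: periodic_fun_eq; rewrite /= fc gd !convolution_fourier.
by congr fourier; apply/funext => j; rewrite mulrC.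
Qed.

Lemma convolution_productA f g h :
  convolution_product f -> convolution_product g -> convolution_product h ->
  convolution f (convolution g h) = convolution (convolution f g) h.
Proof.
move=> /convolution_product_fourier[c fc] /convolution_product_fourier[d gd].
move=> /convolution_product_fourier[e he].
apply: periodic_fun_eq; rewrite /= fc gd he !convolution_fourier.
by congr fourier; apply/funext => j; rewrite mulrA.
Qed.

Lemma convolution_product_S_b : convolution_product (S_b R b).
Proof. exact/convolution_product1/generator_S_b. Qed.

Lemma convolution_product_idl f :
  convolution_product f -> convolution (S_b R b) f = f.
Proof.
move=> /convolution_product_fourier[c fc].
apply: periodic_fun_eq; rewrite sval_convolution S_b_fourier fc convolution_fourier.
by congr fourier; apply/funext => j; rewrite mul1r.
Qed.

Lemma convolution_product_closed f g : convolution_product f ->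
  convolution_product g -> convolution_product (convolution f g).
Proof.
move=> + Gg; elim=> [h gh|h k gh Gk IH]; first exact: convolution_productM.
by rewrite -convolution_productA//; [exact: convolution_productM|exact: convolution_product1].
Qed.

Lemma is_inverse_S_ab_D_ab a : (0 < a)%N -> coprime a b ->
  is_inverse (@convolution_product R b) (@convolution R b) (S_b R b)
    (S_ab R b a) (D_ab R b a).
Proof.
move=> a0 ab.
have GS : convolution_product (S_ab R b a).
  exact/convolution_product1/generator_S_ab.
have GD : convolution_product (D_ab R b a).
  exact/convolution_product1/generator_D_ab.
suff SD : convolution (S_ab R b a) (D_ab R b a) = S_b R b.
  by split=> //; rewrite convolution_productC.
apply: periodic_fun_eq.
rewrite sval_convolution S_ab_fourier D_ab_fourier S_b_fourier convolution_fourier.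
apply/funext => t; congr (_ * _); apply: eq_big_nat => j /andP[j0 jb].
(* If [1 - xi ^ (j a)] vanished, [b] would divide [j a], hence [j] by coprimality, against
   [0 < j < b]. *)
rewrite mulVf// subr_eq0 eq_sym -(prim_order_dvd xi_prim).
by rewrite Gauss_dvdl 1?coprime_sym// gtnNdvd.
Qed.

Lemma is_inverse_sym f g :
  is_inverse (@convolution_product R b) (@convolution R b) (S_b R b) f g ->
  is_inverse (@convolution_product R b) (@convolution R b) (S_b R b) g f.
Proof. by case. Qed.

Lemma generator_inv f : generator f -> exists g,
  is_inverse (@convolution_product R b) (@convolution R b) (S_b R b) f g.
Proof.
have GS := convolution_product_S_b.
case=> [a a0 ab|a a0 ab|].
- by exists (D_ab R b a); exact: is_inverse_S_ab_D_ab.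
- by exists (S_ab R b a); exact/is_inverse_sym/is_inverse_S_ab_D_ab.
- by exists (S_b R b); split=> //; rewrite convolution_product_idl.
Qed.

Lemma convolution_product_inv f : convolution_product f -> exists g,
  is_inverse (@convolution_product R b) (@convolution R b) (S_b R b) f g.
Proof.
elim=> [|g h /generator_inv[g' [Gg Gg' gg' _]] _ [h' [Gh Gh' hh' _]]].
  exact: generator_inv.
have Ggh := convolution_product_closed Gg Gh.
have Ghg' := convolution_product_closed Gh' Gg'.
(* In this order, reassociation alone brings [h] next to [h'], then [g] next to [g']. *)
exists (convolution h' g').
suff E : convolution (convolution g h) (convolution h' g') = S_b R b.
  by split=> //; rewrite convolution_productC.
rewrite -convolution_productA// [convolution h _]convolution_productA// hh'.
by rewrite convolution_product_idl.
Qed.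

End Fourier.

Theorem theorem6 (R : realType) (b : nat) (hb : (2 <= b)%N) :
  is_abelian_group (@convolution_product R b) (@convolution R b) (S_b R b) /\
  (forall a : nat, (0 < a)%N -> coprime a b ->
     is_inverse (@convolution_product R b) (@convolution R b) (S_b R b) (S_ab R b a) (D_ab R b a)).
Proof.
split; last exact: is_inverse_S_ab_D_ab.
split.
- exact: convolution_product_closed.
- exact: convolution_productA.
- exact: convolution_productC.
- exact: convolution_product_S_b.
- exact: convolution_product_idl.
- exact: convolution_product_inv.
Qed.
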